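(* Let $n \ge 1$ and let $T \subset \mathbb{Z}^n$ be a tile. Then there exists $d \ge n$ such that $T$ tiles $\mathbb{Z}^d$.
   Context: A tile is a finite non-empty subset of $\mathbb{Z}^n$ for some $n$. For $d \ge n$, regard $T$ as a subset of $\mathbb{Z}^d$ via the embedding $x \mapsto (x,0,\dots,0)$. A copy of $T$ in $\mathbb{Z}^d$ is a subset of $\mathbb{Z}^d$ isometric to $T$ (with respect to the Euclidean metric). We say $T$ tiles $\mathbb{Z}^d$ if $\mathbb{Z}^d$ can be partitioned into copies of $T$. *)

(* Defs.v *)
From HB Require Import structures.
From mathcomp Require Import all_boot all_order all_algebra.
From mathcomp Require Import finmap.
Set Implicit Arguments. Unset Strict Implicit. Unset Printing Implicit Defensive.
Import Order.TTheory GRing.Theory Num.Theory.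
Local Open Scope ring_scope.
Local Open Scope fset_scope.

Definition pt (d : nat) := {ffun 'I_d -> int}.

(* Squared Euclidean distance on Z^d (isometry w.r.t. the Euclidean metric
   is the same as preserving squared distances). *)
Definition dist2 (d : nat) (x y : pt d) : int :=
  \sum_(i < d) (x i - y i) ^+ 2.

Definition embed (n d : nat) (x : pt n) : pt d :=
  [ffun i : 'I_d => if (insub (val i) : option 'I_n) is Some j then x j else (0 : int)].

Definition is_tile (n : nat) (T : {fset pt n}) : Prop := T != fset0.

Definition is_copy (n d : nat) (T : {fset pt n}) (S : pt d -> Prop) : Prop :=
  exists f : pt d -> pt d,
    (forall x, x \in T -> S (f (embed d x))) /\
    (forall y, S y -> exists2 x, x \in T & f (embed d x) = y) /\
    (forall x y, x \in T -> y \in T ->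
       dist2 (f (embed d x)) (f (embed d y)) = dist2 (embed d x) (embed d y)).

Definition tiles (n : nat) (T : {fset pt n}) (d : nat) : Prop :=
  exists (I : Type) (P : I -> pt d -> Prop),
    (forall i, @is_copy n d T (P i)) /\
    (forall z : pt d, exists! i, P i z).

(* Main.v *)
From HB Require Import structures.
Require Import Defs.
From mathcomp Require Import all_boot all_order all_algebra.
From mathcomp Require Import finmap.
From mathcomp Require Import all_fingroup all_solvable zify.

Set Implicit Arguments.
Unset Strict Implicit.
Unset Printing Implicit Defensive.

(** Modulo a suitable [m] the tile [T] becomes a subset of the finite group [X = (Z/m)^n], and it
suffices to partition a power of [X] into translates of [T] placed along single coordinates.
Translates of [T] cover every point of [X] exactly [t = #|T|] times. For each prime [p | t] some
multiset of translates covers every point [1] mod [p] times, because a [p]-group acting on the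
nonzero space of convolutions of [T] over [F_p] fixes a nonzero vector.

Work in [X^N] with finite sums of indicators of bricks, a brick being a tile along one coordinate
thickened by a condition on finitely many others. A fresh coordinate turns tileability into a game:
we name disjoint pieces [P_1, ..., P_k] of a set and tiles [A_1, ..., A_k], the opponent names [y]
in [X], and the [P_i] with [y] in [A_i] are removed; if every outcome is tileable then so is the
set. The [t]-fold cover removes exactly [t] of the named pieces, and the mod [p] covers combine to
remove [1] mod [t] of them.

Splitting each of several tiles in two gives a cube whose edges are bricks. Removing equally many
even and odd vertices leaves a tileable set, whence so does removing one small cell from a brick.
Finally the game tiles everything except a set that is sparse in some coordinates, shrinks that set
to boundedly many tiny cells, absorbs each of them with a line, and repairs the damage with the
previous fact. *)

Lemma exists_inj_into (I J : finType) (S : {set J}) :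
  #|I| <= #|S| -> exists2 w : I -> J, injective w & forall i, w i \in S.
Proof.
move=> leIS; exists (fun i => enum_val (widen_ord leIS (enum_rank i))) => [i j|i].
  by move=> /enum_val_inj /(congr1 val) /= /ord_inj; apply: enum_rank_inj.
exact: enum_valP.
Qed.

Lemma exists_uncovered (I T : finType) (S : {set I}) (F : I -> {set T}) k :
  (forall i, i \in S -> #|F i| <= k) -> k * #|S| < #|T| ->
  exists t, forall i, i \in S -> t \notin F i.
Proof.
move=> Fk; case: (pickP (fun t => [forall (i | i \in S), t \notin F i])) => [t /forall_inP|cov].
  by exists t.
rewrite ltnNge => /negP[]; apply: leq_trans (_ : \sum_(i in S) #|F i| <= _).
  apply: leq_trans (_ : \sum_(t in T) \sum_(i in S) (t \in F i) <= _).
    rewrite -sum1_card; apply: leq_sum => t _; have /negbT := cov t.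
    rewrite negb_forall_in => /exists_inP[i iS].
    by rewrite negbK (bigD1 i) //= => ->.
  rewrite exchange_big leq_sum // => i _.
  by rewrite -sum1_card [leqRHS]big_mkcond; apply: leq_sum => t _; case: ifP.
by rewrite mulnC -sum_nat_const leq_sum.
Qed.

Lemma sum_at_most_one (I : finType) (P B : pred I) :
  (forall i j, P i -> P j -> B i -> B j -> i = j) ->
  \sum_(i | P i) B i = [exists (i | P i), B i].
Proof.
move=> uniqB; case: (boolP [exists (i | P i), B i]) => [/exists_inP[i Pi Bi]|].
  rewrite (bigD1 i) //= Bi big1 // => j /andP[Pj ji]; apply/eqP; rewrite eqb0.
  by apply: contra ji => Bj; apply/eqP/uniqB.
by rewrite negb_exists_in => /forall_inP nB; rewrite big1 // => i /nB/negPf->.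
Qed.

Lemma sum_eq_mem (T : finType) (S : {set T}) (x : T) : \sum_(y in S) (x == y) = (x \in S).
Proof.
rewrite sum_at_most_one => [|y z _ _ /eqP<- /eqP//]; apply: congr1.
by apply/exists_inP/idP => [[y yS /eqP->]//|xS]; exists x.
Qed.

Lemma exists_modn1_correction p q s : 0 < q * p -> s = 1 %[mod q] ->
  exists2 v, v < q * p & forall c, c = 1 %[mod p] -> s + c * v = 1 %[mod q * p].
Proof.
set r := q * p => r_gt0 s1; have le_s : s <= (r * s).+1 by rewrite leqW // leq_pmull.
pose u := (r * s).+1 - s.
have /dvdnP[a uE] : q %| u %% r.
  rewrite /dvdn modn_dvdm ?dvdn_mulr // -/(q %| u) -eqn_mod_dvd // s1 -addn1.
  by rewrite /r -mulnA mulnC modnMDl.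
exists (u %% r) => [|c c1]; first by rewrite ltn_mod.
have cu : c * (u %% r) = u %% r %[mod r].
  by rewrite uE /r mulnA [c * a * q]mulnC [a * q]mulnC -!muln_modr -modnMml c1 modnMml mul1n.
by rewrite -modnDmr cu modnDmr modnDmr subnKC // -addn1 mulnC modnMDl.
Qed.

Lemma card_balanced (T : finType) (even D E : {set T}) (a : T) :
  a \in even -> D \subset ~: even -> E \subset even :\ a ->
  #|([set a] :|: D :|: E) :&: even| = #|E|.+1 /\ #|([set a] :|: D :|: E) :\: even| = #|D|.
Proof.
rewrite -disjoints_subset => even_a odd_D; rewrite subsetD1 => /andP[even_E aE].
have even_aE : a |: E \subset even by rewrite subUset sub1set even_a.
rewrite setUAC setIUl setDUl (setIidPl even_aE) (disjoint_setI0 odd_D) (setDidPl odd_D) setU0.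
have /eqP-> : (a |: E) :\: even == set0 by rewrite setD_eq0.
by rewrite set0U cardsU1 aE.
Qed.

Section SubPair.

Variables (T : finType) (A : {set T}) (a b : T).
Hypothesis ab : a != b.

Lemma eq_setD1_set1 : (A :\ b == [set a]) = (A \subset [set a; b]) && (a \in A).
Proof. by rewrite eqEsubset subDset setUC sub1set in_setD1 ab. Qed.

Lemma eq_set1_sub_pair : (A == [set a]) = [&& A \subset [set a; b], a \in A & b \notin A].
Proof.
rewrite andbA -eq_setD1_set1; case: (boolP (b \in A)) => bA /=; last first.
  by rewrite andbT (setDidPl _) // disjoint_sym disjoints1.
by rewrite andbF; apply: contraTF bA => /eqP->; rewrite inE eq_sym.
Qed.

Lemma sub_pair_neq0 : A \subset [set a; b] -> (A != set0) = (a \in A) || (b \in A).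
Proof.
move=> sub; apply/set0Pn/orP => [[c cA]|[]]; [|by exists a|by exists b].
by have /(subsetP sub)/set2P[<-|<-] := cA; [left|right].
Qed.

End SubPair.

(** * Functions of finitely many coordinates *)

Section Coordinates.

Variable X : eqType.
Local Notation point := (nat -> X).

Definition depends_on (S : {pred nat}) (V : Type) (f : point -> V) : Prop :=
  forall x y, {in S, x =1 y} -> f x = f y.

Definition finitary_off (S : {pred nat}) (V : Type) (f : point -> V) : Prop :=
  exists d, depends_on [pred j | (j < d) && (j \notin S)] f.

Lemma depends_onW (S S' : {pred nat}) V (f : point -> V) :
  {subset S <= S'} -> depends_on S f -> depends_on S' f.
Proof. by move=> SS' fS x y xy; apply: fS => j /SS'; apply: xy. Qed.

Lemma finitary_offW (S S' : {pred nat}) V (f : point -> V) :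
  {subset S' <= S} -> finitary_off S f -> finitary_off S' f.
Proof.
move=> S'S [d fd]; exists d; apply: depends_onW fd => j /andP[jd jS].
by rewrite inE jd; apply: contra jS; apply: S'S.
Qed.

Lemma finitary_off_coord (S : {pred nat}) i : i \notin S -> finitary_off S (fun x => x i).
Proof. by move=> iS; exists i.+1 => x y; apply; rewrite inE ltnSn. Qed.

Lemma finitary_off_const (S : {pred nat}) V (v : V) : finitary_off S (fun=> v).
Proof. by exists 0. Qed.

Lemma finitary_off_comp (S : {pred nat}) V W (h : V -> W) f :
  finitary_off S f -> finitary_off S (fun x => h (f x)).
Proof. by move=> [d fd]; exists d => x y /fd->. Qed.

Lemma finitary_off_comp2 (S : {pred nat}) U V W (h : U -> V -> W) f g :
  finitary_off S f -> finitary_off S g -> finitary_off S (fun x => h (f x) (g x)).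
Proof.
move=> [d fd] [e ge]; exists (maxn d e) => x y xy.
congr h; [apply: fd|apply: ge] => j /andP[jlt jS]; apply: xy;
  by rewrite inE leq_max jlt ?orbT.
Qed.

Lemma finitary_off_family (S : {pred nat}) (I : finType) (V : I -> Type)
    (f : forall i, point -> V i) W (h : point -> W) :
  (forall i, finitary_off S (f i)) ->
  (forall x y, (forall i, f i x = f i y) -> h x = h y) -> finitary_off S h.
Proof.
move=> /fin_all_exists[d fd] hf; exists (\max_i d i) => x y xy; apply: hf => i.
apply: fd => j /andP[jd jS]; apply: xy; rewrite inE jS andbT.
exact: leq_trans jd (leq_bigmax i).
Qed.

Lemma finitary_off_bind (S : {pred nat}) (I : finType) V (f : I -> point -> V) (g : point -> I) :
  (forall i, finitary_off S (f i)) -> finitary_off S g -> finitary_off S (fun x => f (g x) x).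
Proof.
move=> /fin_all_exists[d fd] [e ge]; exists (maxn (\max_i d i) e) => x y xy.
rewrite (ge x y) => [|j /andP[je jS]]; last by apply: xy; rewrite inE leq_max je orbT.
apply: fd => j /andP[jd jS]; apply: xy; rewrite inE jS andbT leq_max.
by rewrite (leq_trans jd) ?leq_bigmax.
Qed.

Definition agree (s : seq nat) (x y : point) : bool := all (fun j => x j == y j) s.

Lemma agreeP s x y : reflect {in s, x =1 y} (agree s x y).
Proof. by apply: (iffP allP) => xy j /xy /eqP. Qed.

Lemma agree_filter s l x y :
  l \in s -> agree s x y = agree [seq j <- s | j != l] x y && (x l == y l).
Proof.
move=> ls; apply/agreeP/andP => [xy|[/agreeP xy /eqP xyl] j js].
  split; last by rewrite xy.
  by apply/agreeP=> j; rewrite mem_filter => /andP[_]; apply: xy.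
by case: (eqVneq j l) => [->//|jl]; apply: xy; rewrite mem_filter jl.
Qed.

Lemma finitary_off_agree (S : {pred nat}) s y :
  {in s, forall j, j \notin S} -> finitary_off S (fun x => agree s x y).
Proof.
move=> sS; exists (\max_(j <- s) j).+1 => x x' xx'; apply: eq_in_all => j js.
by rewrite xx' // inE sS // ltnS leq_bigmax_seq.
Qed.

Definition overwrite (I : finType) (pos : I -> nat) (w : I -> X) (x : point) : point :=
  fun j => if [pick i | pos i == j] is Some i then w i else x j.

Lemma overwrite_pos (I : finType) (pos : I -> nat) w x i :
  injective pos -> overwrite pos w x (pos i) = w i.
Proof.
move=> pos_inj; rewrite /overwrite; case: pickP => [j /eqP/pos_inj->//|/(_ i)].
by rewrite eqxx.
Qed.

Lemma overwrite_out (I : finType) (pos : I -> nat) w x j :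
  j \notin codom pos -> overwrite pos w x j = x j.
Proof.
by move=> jpos; rewrite /overwrite; case: pickP => // i /eqP ij; rewrite -ij codom_f in jpos.
Qed.

Lemma overwrite_id (I : finType) (pos : I -> nat) w x :
  (forall i, x (pos i) = w i) -> overwrite pos w x =1 x.
Proof. by move=> xw j; rewrite /overwrite; case: pickP => // i /eqP<-. Qed.

Lemma finitary_off_overwrite (I : finType) (pos : I -> nat) w V (f : point -> V) :
  finitary_off pred0 f -> finitary_off (mem (codom pos)) (fun x => f (overwrite pos w x)).
Proof.
move=> [d fd]; exists d => x y xy; apply: fd => j /andP[jd _]; rewrite /overwrite.
case: pickP => // jpos; apply: xy; rewrite inE jd; apply/codomP=> -[i ji].
by have := jpos i; rewrite ji eqxx.
Qed.

Definition window (b : nat) (x : point) : {ffun 'I_b -> X} := [ffun j : 'I_b => x j].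

Definition set_window (b : nat) (w : {ffun 'I_b -> X}) : point -> point :=
  overwrite (@nat_of_ord b) w.

Lemma window_set_window b (w : {ffun 'I_b -> X}) x : window b (set_window w x) = w.
Proof. by apply/ffunP=> j; rewrite ffunE; apply: overwrite_pos (@ord_inj b). Qed.

Lemma set_window_ge b (w : {ffun 'I_b -> X}) x j : b <= j -> set_window w x j = x j.
Proof.
move=> bj; apply: overwrite_out; apply/negP=> /codomP[i ji].
by move: (ltn_ord i); rewrite -ji ltnNge bj.
Qed.

Lemma set_window_lt b x y j : j < b -> set_window (window b x) y j = x j.
Proof.
move=> jb; rewrite -[j]/(nat_of_ord (Ordinal jb)) /set_window overwrite_pos ?ffunE //.
exact: ord_inj.
Qed.

Lemma agree_window b x y : agree (iota 0 b) x y = (window b x == window b y).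
Proof.
apply/agreeP/eqP => [xy|/ffunP xy j].
  by apply/ffunP=> j; rewrite !ffunE xy // mem_iota ltn_ord.
by rewrite mem_iota => /= jb; have := xy (Ordinal jb); rewrite !ffunE.
Qed.

Lemma finitary_window b (V : Type) (f : {ffun 'I_b -> X} -> V) :
  finitary_off pred0 (fun x => f (window b x)).
Proof.
apply: (finitary_off_family (f := fun (j : 'I_b) x => x j)) => [j|x y xy].
  exact: finitary_off_coord.
by congr f; apply/ffunP=> j; rewrite !ffunE.
Qed.

End Coordinates.

(** * Sums of bricks *)

Section Bricks.

Variables (X K : finType) (tile : K -> {set X}).
Local Notation point := (nat -> X).
Local Notation finitary := (finitary_off pred0).

Record brick := Brick {base : pred point; axis : nat; label : K}.

Definition in_brick (B : brick) : pred point :=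
  fun x => base B x && (x (axis B) \in tile (label B)).

Definition brick_below (d : nat) (B : brick) : Prop :=
  axis B < d /\ depends_on [pred j | (j < d) && (j != axis B)] (base B).

Definition tileable_below (d : nat) (f : point -> nat) : Prop :=
  exists (I : finType) (B : I -> brick),
    (forall i, brick_below d (B i)) /\ forall x, f x = \sum_i in_brick (B i) x.

Definition tileable (f : point -> nat) : Prop := exists d, tileable_below d f.

Lemma tileable_below_leq d e f : d <= e -> tileable_below d f -> tileable_below e f.
Proof.
move=> de [I [B [Bd fE]]]; exists I, B; split=> // i; have [axd dep] := Bd i.
split; first exact: leq_trans de.
by apply: depends_onW dep => j /andP[jd jax]; rewrite inE jax (leq_trans jd).
Qed.

Lemma tileable_below_slice d e (y : X) f :
  d <= e -> tileable_below d f -> tileable_below e.+1 (fun x => (x e == y) * f x).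
Proof.
move=> de [I [B [Bd fE]]].
exists I, (fun i => Brick (fun x => (x e == y) && base (B i) x) (axis (B i)) (label (B i))).
split=> [i|x]; last first.
  by rewrite fE big_distrr /=; apply: eq_bigr => i _; rewrite /in_brick mulnb andbA.
have [axd dep] := Bd i; have axe := leq_trans axd de; split=> /=; first exact: leqW.
move=> x z xz; rewrite (xz e) ?(dep x z) // => [j /andP[jd jax]|].
  by apply: xz; rewrite inE jax (leq_trans jd) // leqW.
by rewrite inE ltnSn gtn_eqF.
Qed.

Lemma tileable_ext f g : f =1 g -> tileable f -> tileable g.
Proof. by move=> fg [d [I [B [Bd fE]]]]; exists d, I, B; split=> // x; rewrite -fg. Qed.

Lemma tileable0 : tileable (fun=> 0).
Proof. by exists 0, void, (of_void brick); split=> [[]|x]; rewrite ?big_pred0 => [|[]]. Qed.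

Lemma tileableD f g : tileable f -> tileable g -> tileable (fun x => f x + g x).
Proof.
move=> [d tf] [e tg].
have [I [B [Bde fE]]] := tileable_below_leq (leq_maxl d e) tf.
have [I' [B' [B'de gE]]] := tileable_below_leq (leq_maxr d e) tg.
exists (maxn d e), (I + I')%type, (fun i => match i with inl i => B i | inr i => B' i end).
by split=> [[]//|x]; rewrite big_sumType /= fE gE.
Qed.

Lemma tileable_sum (I : Type) (r : seq I) (P : pred I) (f : I -> point -> nat) :
  (forall i, P i -> tileable (f i)) -> tileable (fun x => \sum_(i <- r | P i) f i x).
Proof.
move=> gf; elim: r => [|i r IH]; first by apply: tileable_ext tileable0 => x; rewrite big_nil.
case Pi: (P i); last by apply: tileable_ext IH => x; rewrite big_cons Pi.
by apply: tileable_ext (tileableD (gf i Pi) IH) => x; rewrite big_cons Pi.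
Qed.

Lemma tileable_brick (C : pred point) i k :
  finitary_off (pred1 i) C -> tileable (fun x => C x && (x i \in tile k)).
Proof.
move=> [d Cd]; exists (maxn d i.+1), unit, (fun=> Brick C i k); split=> [_|x].
  split; first by rewrite leq_max ltnSn orbT.
  by apply: depends_onW Cd => j /andP[jd ji]; rewrite inE leq_max jd.
by rewrite big_const card_unit /= addn0.
Qed.

(* The opponent's answer [y] is read off a coordinate [e] on which nothing in play depends yet. *)
Lemma tileable_play (J : finType) (labels : J -> K) (P : J -> pred point) (R : X -> point -> nat) :
  (forall j, finitary (P j)) -> (forall y, tileable (R y)) ->
  exists e0, forall e, e0 <= e ->
    tileable (fun x => R (x e) x + \sum_j (P j x && (x e \in tile (labels j)))).
Proof.
move=> /fin_all_exists[dP Pd] /fin_all_exists[dR Rd].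
exists (maxn (\max_j dP j) (\max_y dR y)) => e.
rewrite geq_max => /andP[/bigmax_leqP Pe /bigmax_leqP Re]; apply: tileableD.
  apply: (@tileable_ext (fun x => \sum_y (x e == y) * R y x)) => [x|].
    rewrite (bigD1 (x e)) //= eqxx mul1n big1 ?addn0 // => y.
    by rewrite eq_sym => /negPf->.
  by apply: tileable_sum => y _; exists e.+1; apply: tileable_below_slice (Rd y); apply: Re.
apply: tileable_sum => j _; apply: tileable_brick; exists (dP j).
apply: depends_onW (Pd j) => l /andP[ld _].
by rewrite !inE ld ltn_eqF // (leq_trans ld) // Pe.
Qed.

Definition game_closed (Q : (point -> nat) -> Prop) : Prop :=
  forall (J : finType) (labels : J -> K) (P : J -> pred point) (R : X -> point -> nat) f,
    (forall j, finitary (P j)) -> (forall y, Q (R y)) ->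
    (forall y x, f x = R y x + \sum_j (P j x && (y \in tile (labels j)))) -> Q f.

Lemma tileable_game_closed : game_closed tileable.
Proof.
move=> J labels P R f finP gR fE; have [e /(_ e (leqnn e))] := tileable_play labels finP gR.
by apply: tileable_ext => x; rewrite -fE.
Qed.

Lemma game_closed_ext Q f g : game_closed Q -> f =1 g -> Q f -> Q g.
Proof.
move=> gameQ fg Qf.
apply: (gameQ void (of_void K) (fun _ _ => false) (fun=> f)) => // y x.
by rewrite big_pred0 ?addn0 ?fg //; case.
Qed.

Definition carve (I : finType) (f : point -> nat) (P : I -> pred point) (D : {set I}) :
  point -> nat := fun x => f x - \sum_(i in D) P i x.

Definition packed (I : finType) (f : point -> nat) (P : I -> pred point) (S : {set I}) : Prop :=
  forall x, \sum_(i in S) P i x <= f x.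

Lemma carve0 (I : finType) f (P : I -> pred point) : carve f P set0 =1 f.
Proof. by move=> x; rewrite /carve big_set0 subn0. Qed.

Lemma carve_carve (I : finType) f (P : I -> pred point) (D E : {set I}) :
  [disjoint D & E] -> carve (carve f P D) P E =1 carve f P (D :|: E).
Proof.
move=> DE x; rewrite /carve -subnDA -bigU //=; congr (_ - _).
by apply: eq_bigl => i; rewrite !inE.
Qed.

Lemma packed_sub (I : finType) f (P : I -> pred point) (D S : {set I}) :
  D \subset S -> packed f P S -> packed f P D.
Proof.
move=> DS PS x; apply: leq_trans (PS x).
by rewrite [leqRHS](big_setID D) /= (setIidPr DS) leq_addr.
Qed.

Lemma packed_carve (I : finType) f (P : I -> pred point) (D S : {set I}) :
  D \subset S -> packed f P S -> packed (carve f P D) P (S :\: D).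
Proof.
move=> DS PS x; rewrite /carve leq_subRL ?(packed_sub DS PS) //.
by have := PS x; rewrite (big_setID D) /= (setIidPr DS).
Qed.

(* [N] pieces suffice for a game after which the number of removed pieces satisfies [c]. *)
Definition removable (Q : (point -> nat) -> Prop) (N : nat) (c : pred nat) : Prop :=
  forall (I : finType) (f : point -> nat) (P : I -> pred point) (S : {set I}),
    (forall i, finitary (P i)) -> packed f P S -> N <= #|S| ->
    (forall D : {set I}, D \subset S -> #|D| <= N -> c #|D| -> Q (carve f P D)) -> Q f.

Definition degree (w : K -> nat) (y : X) : nat := \sum_(k | y \in tile k) w k.

Section Covers.

Variable t : nat.
Hypothesis t_gt0 : 0 < t.
Hypothesis degree_t : forall y, degree (fun=> 1) y = t.
Hypothesis prime_cover :
  forall p, prime p -> p %| t -> exists w, forall y, degree w y = 1 %[mod p].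

Section Game.

Variable Q : (point -> nat) -> Prop.
Hypothesis gameQ : game_closed Q.

Lemma removableW N N' (c c' : pred nat) :
  removable Q N c -> N <= N' -> (forall s, s <= N -> c s -> c' s) -> removable Q N' c'.
Proof.
move=> rN NN' cc' I f P S finP PS N'S hD; apply: (rN I f P S) => // [|D DS DN cD].
  exact: leq_trans N'S.
by apply: hD; [|apply: leq_trans NN'|apply: cc'].
Qed.

Lemma removable0 : removable Q 0 (pred1 0).
Proof.
move=> I f P S _ _ _ /(_ set0 (sub0set S)); rewrite cards0 => /(_ isT isT).
exact: game_closed_ext (carve0 f P).
Qed.

Lemma removableD N N' (c c' : pred nat) :
  removable Q N c ->
  (forall s, s <= N -> c s -> removable Q N' [pred s' | c' (s + s')]) ->
  removable Q (N + N') c'.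
Proof.
move=> rN rN' I f P S finP PS NS hD; apply: (rN I f P S) => // [|D DS DN cD].
  by apply: leq_trans NS; apply: leq_addr.
apply: (rN' _ DN cD I _ P (S :\: D)) => // [||E].
- exact: packed_carve.
- rewrite cardsD (setIidPr DS) leq_subRL ?subset_leq_card //.
  by apply: leq_trans NS; rewrite leq_add2r.
rewrite subsetD disjoint_sym => /andP[ES DE] EN cE.
have cDE : #|D :|: E| = #|D| + #|E| by rewrite cardsU disjoint_setI0 // cards0 subn0.
apply: game_closed_ext gameQ (fsym (carve_carve f P DE)) _.
by apply: hD; rewrite ?subUset ?DS ?ES // cDE // leq_add.
Qed.

Lemma removable_degree w :
  removable Q (\sum_k w k) [pred s | [exists y, s == degree w y]].
Proof.
move=> I f P S finP PS; pose J : finType := {k : K & 'I_(w k)}.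
have -> : \sum_k w k = #|J|.
  rewrite -sum1_card -(sig_big_dep xpredT (fun _ => xpredT) (fun _ _ => 1)) /=.
  by apply: eq_bigr => k _; rewrite sum1_card card_ord.
move=> /exists_inj_into[v v_inj vS] hD.
pose removed y := v @: [set j : J | y \in tile (tag j)].
have removedS y : removed y \subset S by apply/subsetP=> i /imsetP[j _ ->].
apply: (gameQ (J := J) (labels := tag) (P := fun j => P (v j))
  (R := fun y => carve f P (removed y))) => //.
  move=> y; apply: hD => //.
    by rewrite card_imset // max_card.
  apply/existsP; exists y; rewrite card_imset // -sum1_card /degree.
  rewrite (eq_bigr (fun k => \sum_(j < w k) 1)) => [|k _]; last by rewrite sum1_card card_ord.
  by rewrite sig_big_dep /=; apply/eqP; apply: eq_bigl => j; rewrite inE andbT.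
move=> y x.
have -> : \sum_j (P (v j) x && (y \in tile (tag j))) = \sum_(i in removed y) P i x.
  rewrite big_imset /= => [|? ? _ _]; last exact: v_inj.
  rewrite [RHS]big_mkcond; apply: eq_bigr => j _ /=; rewrite inE.
  by case: ifP; rewrite ?andbT ?andbF.
by rewrite subnK // (packed_sub (removedS y) PS).
Qed.

Lemma removable_cover : removable Q #|K| (pred1 t).
Proof.
apply: removableW (@removable_degree (fun=> 1)) _ _ => [|s _ /existsP[y]].
  by rewrite sum1_card.
by rewrite degree_t.
Qed.

Lemma removable_mul g : removable Q (g * #|K|) (pred1 (g * t)).
Proof.
elim: g => [|g IH]; first exact: removable0.
rewrite mulSn; apply: removableD removable_cover _ => s _ /eqP->.
by apply: removableW IH _ _ => // s' _ /= /eqP->; rewrite mulSn.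
Qed.

Lemma game_few_pieces (I : finType) (f : point -> nat) (P : I -> pred point) (S : {set I}) :
  (forall i, finitary (P i)) -> packed f P S ->
  (forall D : {set I}, D \subset S -> #|S :\: D| <= #|K| -> Q (carve f P D)) -> Q f.
Proof.
move=> finP; move Sn: #|S| => n; elim/ltn_ind: n => n IH in f S Sn * => PS hD.
case: (leqP #|S| #|K|) => [leSK|/ltnW leKS].
  by apply: game_closed_ext gameQ (carve0 f P) _; apply: hD; rewrite ?sub0set ?setD0.
apply: (removable_cover finP PS leKS) => D DS _ /eqP Dt.
have ltSn : #|S :\: D| < n.
  by rewrite -Sn -[ltnRHS](cardsID D) (setIidPr DS) Dt -[ltnLHS]add0n ltn_add2r.
apply: (IH _ ltSn _ _ erefl (packed_carve DS PS)) => E.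
rewrite subsetD disjoint_sym => /andP[ES DE] few.
apply: game_closed_ext gameQ (fsym (carve_carve f P DE)) _; apply: hD.
  by rewrite subUset DS.
by rewrite -setDDl.
Qed.

Lemma removable_mod1 r :
  r %| t -> exists N, removable Q N [pred s | (0 < s) && (s == 1 %[mod r])].
Proof.
elim/ltn_ind: r => r IH rt; have r_gt0 : 0 < r by apply: dvdn_gt0 rt.
case: (leqP r 1) => [r_le1|r_gt1].
  have -> : r = 1 by lia.
  exists #|K|; apply: removableW removable_cover _ _ => // s _ /eqP->.
  by rewrite inE t_gt0 !modn1 eqxx.
have p_pr := pdiv_prime r_gt1; have /dvdnP[q rE] := pdiv_dvd r.
set p := pdiv r in p_pr rE; have p_gt1 := prime_gt1 p_pr.
have q_lt : q < r by rewrite rE in r_gt0 *; nia.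
have [|N removeN] := IH q q_lt; first by apply: dvdn_trans rt; rewrite rE dvdn_mulr.
have [|w w1] := prime_cover p_pr; first by apply: dvdn_trans rt; rewrite rE dvdn_mull.
exists (N + r * \sum_k w k); apply: (removableD removeN) => s _ /andP[s_gt0 /eqP s1].
have [|v v_lt correct] := @exists_modn1_correction p q s _ s1; first by rewrite -rE.
apply: removableW (@removable_degree (fun k => v * w k)) _ _ => [|s' _ /existsP[y /eqP->]].
  by rewrite -big_distrr leq_mul2r rE (ltnW v_lt) orbT.
by rewrite /= addn_gt0 s_gt0 /degree -big_distrr /= mulnC rE correct ?w1.
Qed.

(* Remove [s = 1] mod [t] odd pieces, then [s - 1] even ones besides [a]. *)
Lemma game_balance : exists N,
  forall (I : finType) f (P : I -> pred point) (even : {set I}) (a : I),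
    (forall i, finitary (P i)) -> packed f P setT ->
    a \in even -> N <= #|even :\ a| -> N <= #|~: even| ->
    (forall W : {set I}, #|W :&: even| = #|W :\: even| -> Q (carve f P W)) ->
    Q (carve f P [set a]).
Proof.
have [N removeN] := removable_mod1 (dvdnn t).
exists (N + N * #|K|) => I f P even a finP packedP even_a leN_even leN_odd hQ.
have packed_off (D S : {set I}) : [disjoint S & D] -> packed (carve f P D) P S.
  move=> SD; apply: (packed_sub (S := setT :\: D)); first by rewrite subsetD subsetT.
  exact: packed_carve (subsetT D) packedP.
have odd_a : [disjoint [set a] & ~: even] by rewrite disjoints1 inE even_a.
apply: (removeN _ _ _ (~: even)) => // [||D1 D1_odd D1N].
- by apply: packed_off; rewrite disjoint_sym.
- by apply: leq_trans leN_odd; apply: leq_addr.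
rewrite /= => /andP[D1_gt0 /eqP D1_mod].
have /dvdnP[g gE] : t %| #|D1|.-1 by rewrite -subn1 -eqn_mod_dvd //; apply/eqP.
have D1a : [disjoint [set a] & D1] by apply: disjointWr odd_a.
apply: game_closed_ext gameQ (fsym (carve_carve f P D1a)) _.
have disj_even (D2 : {set I}) : D2 \subset even :\ a -> [disjoint [set a] :|: D1 & D2].
  move=> /subsetP D2E; apply/pred0P=> i /=; apply/negP=> /andP[+ /D2E].
  by rewrite !inE => /orP[->//|/(subsetP D1_odd)]; rewrite inE => /negPf->; rewrite andbF.
apply: (@removable_mul g _ _ _ (even :\ a)) => // [||D2 D2E _ /eqP D2g].
- by apply: packed_off; rewrite disjoint_sym disj_even.
- apply: leq_trans leN_even; rewrite (leq_trans _ (leq_addl _ _)) // leq_mul2r.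
  apply/orP; right; apply: leq_trans D1N; apply: leq_trans (leq_pred _); rewrite gE.
  exact: leq_pmulr.
apply: game_closed_ext gameQ (fsym (carve_carve f P (disj_even D2 D2E))) _; apply: hQ.
have [-> ->] := card_balanced even_a D1_odd D2E.
by rewrite D2g -gE prednK.
Qed.

End Game.

Definition sparse (b N : nat) (O : pred point) : Prop :=
  forall x, #|[set w : {ffun 'I_b -> X} | O (set_window w x)]| <= N.

Definition tileable_off_sparse (b N : nat) (f : point -> nat) : Prop :=
  exists O : pred point,
    [/\ finitary O, sparse b N O & exists2 g, tileable g & forall x, f x = g x + O x].

Lemma tileable_off_sparse_game_closed b N : game_closed (tileable_off_sparse b N).
Proof.
move=> J labels P R f finP /fin_all_exists[O hO] fE.
have /fin_all_exists2[g tileable_g RE] y : exists2 g, tileable g & forall x, R y x = g x + O y x.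
  by case: (hO y).
have [e0 play] := tileable_play labels finP tileable_g; pose e := maxn e0 b.
exists (fun x => O (x e) x); split.
- apply: (@finitary_off_bind _ _ _ _ O (fun x => x e)) => [y|]; last exact: finitary_off_coord.
  by case: (hO y).
- move=> x; have [_ sparseO _] := hO (x e); apply: leq_trans (sparseO x).
  by apply/subset_leq_card/subsetP=> w; rewrite !inE set_window_ge ?leq_maxr.
- exists (fun x => g (x e) x + \sum_j (P j x && (x e \in tile (labels j)))).
    exact: play (leq_maxl _ _).
  by move=> x; rewrite (fE (x e)) RE addnAC.
Qed.

Lemma sparse_hole b : exists O : pred point,
  [/\ finitary O, sparse b #|K| O & tileable (fun x => ~~ O x)].
Proof.
pose P (w : {ffun 'I_b -> X}) x := window b x == w.
have : tileable_off_sparse b #|K| (fun=> 1).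
  apply: (game_few_pieces (@tileable_off_sparse_game_closed _ _) (P := P) (S := setT))
    => [w|x|D _ few].
  - exact: (finitary_window (fun v => v == w)).
  - by rewrite sum_eq_mem leq_b1.
  exists (fun x => window b x \notin D); split.
  - exact: (finitary_window (fun v => v \notin D)).
  - move=> x; apply: leq_trans few; rewrite setTD subset_leq_card //.
    by apply/subsetP=> w; rewrite !inE window_set_window.
  exists (fun=> 0) => [|x]; first exact: tileable0.
  by rewrite /carve sum_eq_mem; case: (_ \in D).
case=> O [finO sparseO [g tileable_g gE]]; exists O; split=> //.
by apply: tileable_ext tileable_g => x; have := gE x; case: (O x) => /=; lia.
Qed.

(** * Removing one small cell from a brick *)

Section Cells.

Variables (L : finType) (coord : L -> nat) (labels : L -> K) (upper : L -> pred X).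
Hypothesis coord_inj : injective coord.

Definition inside : pred point := fun x => [forall l, x (coord l) \in tile (labels l)].

Definition side (x : point) : {set L} := [set l | upper l (x (coord l))].

Definition cell (l : L) : pred point := fun x => inside x && (side x == [set l]).

Lemma inside_ext x y : (forall l, x (coord l) = y (coord l)) -> inside x = inside y.
Proof. by move=> xy; apply: eq_forallb => l; rewrite xy. Qed.

Lemma side_ext x y : (forall l, x (coord l) = y (coord l)) -> side x = side y.
Proof. by move=> xy; apply/setP=> l; rewrite !inE xy. Qed.

Lemma finitary_off_coords (S : {pred nat}) V (h : point -> V) :
  (forall l, coord l \notin S) ->
  (forall x y, (forall l, x (coord l) = y (coord l)) -> h x = h y) -> finitary_off S h.
Proof.
move=> coordS; apply: (finitary_off_family (f := fun l x => x (coord l))) => l.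
exact: finitary_off_coord.
Qed.

Lemma finitary_off_other_coords l V (h : point -> V) :
  (forall x y, (forall l', l' != l -> x (coord l') = y (coord l')) -> h x = h y) ->
  finitary_off (pred1 (coord l)) h.
Proof.
move=> hP; apply: (finitary_off_family
  (f := fun l' x => if l' == l then None else Some (x (coord l')))) => [l'|x y xy].
  case: eqVneq => [_|l'l]; first exact: finitary_off_const.
  apply: (finitary_off_comp Some); apply: finitary_off_coord.
  by rewrite inE (inj_eq coord_inj).
by apply: hP => l' /negPf l'l; have := xy l'; rewrite l'l => -[].
Qed.

Lemma tileable_inside (B : pred point) l :
  finitary_off (pred1 (coord l)) B -> tileable (fun x => B x && inside x).
Proof.
move=> finB; pose C x := B x && [forall (l' | l' != l), x (coord l') \in tile (labels l')].
apply: (@tileable_ext (fun x => C x && (x (coord l) \in tile (labels l)))) => [x|].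
  congr (nat_of_bool _); rewrite /C -andbA; congr (_ && _).
  apply/andP/forallP => [[/forall_inP others own] l'|all_in].
    by case: (eqVneq l' l) => [->//|]; apply: others.
  by split=> //; apply/forall_inP.
apply/tileable_brick/finitary_off_comp2 => //; apply: finitary_off_other_coords => x y xy.
by apply: eq_forallb => l'; case: eqVneq => //= /xy->.
Qed.

Variables (B : brick) (G : pred point) (even : {set L}).
Hypothesis fin_base : finitary_off [predU1 axis B & codom coord] (base B).
Hypothesis finG : finitary_off (mem (codom coord)) G.
Hypothesis axis_coord : axis B \notin codom coord.

Definition vertex (l : L) : pred point :=
  fun x => [&& in_brick B x, G x == (l \in even) & cell l x].

Let fin_brick : finitary_off (mem (codom coord)) (in_brick B).
Proof.
apply: finitary_off_comp2; last first.
  by apply: (finitary_off_comp (mem (tile (label B)))); apply: finitary_off_coord.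
by apply: finitary_offW fin_base => j jcoord; rewrite inE jcoord orbT.
Qed.

Lemma finitary_vertex l : finitary_off pred0 (vertex l).
Proof.
have finW V (f : point -> V) : finitary_off (mem (codom coord)) f -> finitary_off pred0 f.
  exact: finitary_offW.
apply: finitary_off_comp2; first exact: finW.
apply: finitary_off_comp2; first exact: (finitary_off_comp (eq_op^~ (l \in even))) (finW _ _ finG).
by apply: finitary_off_coords => // x y xy; rewrite /cell (inside_ext xy) (side_ext xy).
Qed.

Lemma packed_vertex (W : {set L}) : packed (in_brick B) vertex W.
Proof.
move=> x; rewrite sum_at_most_one => [|l l' _ _ /and4P[_ _ _ /eqP sl] /and4P[_ _ _]].
  by case: exists_inP => // -[l _ /andP[->]].
by rewrite sl => /eqP/set1_inj.
Qed.

(* The cells [{a}], [{a, b}], [{b}] form a path of the cube: outside [G] the brick is repaired by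
   the edge through [{a}], inside [G] by the edge through [{b}]. *)
Definition path_edges (a b : L) : point -> nat := fun x =>
  ([&& in_brick B x, ~~ G x & side x :\ b == [set a]] && inside x)
  + ([&& in_brick B x, G x & side x :\ a == [set b]] && inside x).

Definition path_cells (a b : L) : pred point :=
  fun x => [&& inside x, side x != set0 & side x \subset [set a; b]].

Lemma tileable_path_edges a b : tileable (path_edges a b).
Proof.
have finW l (C : pred point) :
    finitary_off (mem (codom coord)) C -> finitary_off (pred1 (coord l)) C.
  by apply: finitary_offW => j; rewrite inE => /eqP->; apply: codom_f.
have fin_side c d : finitary_off (pred1 (coord c)) (fun x => side x :\ c == [set d]).
  apply: finitary_off_other_coords => x y xy; congr (_ == _); apply/setP=> l.
  by rewrite !inE; case: eqVneq => //= /xy->.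
apply: tileableD; [apply: (@tileable_inside _ b)|apply: (@tileable_inside _ a)];
  apply: finitary_off_comp2 (finW _ _ fin_brick) _; apply: finitary_off_comp2 (fin_side _ _);
  by [apply: (finitary_off_comp negb) (finW _ _ finG)|apply: finW].
Qed.

Lemma path_edgesE a b x : a \in even -> b \notin even ->
  vertex a x + vertex b x + path_edges a b x = in_brick B x && path_cells a b x.
Proof.
move=> ea ob; have ab : a != b by apply: contraNneq ob => <-.
rewrite /vertex /path_edges /path_cells /cell ea (negPf ob) eqb_id eqbF_neg.
have ba : b != a by rewrite eq_sym.
rewrite !(eq_setD1_set1 (side x)) ?(eq_set1_sub_pair (side x) ab) //.
rewrite (eq_set1_sub_pair (side x) ba) (setUC [set b]).
case: (boolP (side x \subset _)) => [/sub_pair_neq0->|]; rewrite ?andbF //=.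
by case: (in_brick B x); case: (G x); case: (inside x); case: (a \in _); case: (b \in _).
Qed.

Lemma tileable_paths (I : finType) (a b : I -> L) :
  injective a -> injective b -> (forall j, a j \in even) -> (forall j, b j \notin even) ->
  tileable (fun x => in_brick B x - \sum_j (vertex (a j) x + vertex (b j) x)).
Proof.
move=> a_inj b_inj ea ob.
have path_uniq x j j' : path_cells (a j) (b j) x -> path_cells (a j') (b j') x -> j = j'.
  move=> /and3P[_ /set0Pn[l lx] /subsetP/(_ l lx)] + /and3P[_ _ /subsetP/(_ l lx)].
  move=> /set2P[->|->] /set2P[].
  - exact: a_inj.
  - by move=> ab; have := ob j'; rewrite -ab ea.
  - by move=> ba; have := ob j; rewrite ba ea.
  - exact: b_inj.
pose rest x :=
  (base B x && ~~ [exists j, path_cells (a j) (b j) x]) && (x (axis B) \in tile (label B)).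
apply: (@tileable_ext (fun x => rest x + \sum_j path_edges (a j) (b j) x)) => [x|].
  have : \sum_j (vertex (a j) x + vertex (b j) x) + \sum_j path_edges (a j) (b j) x
      = in_brick B x && [exists j, path_cells (a j) (b j) x].
    rewrite -big_split /= (eq_bigr _ (fun j _ => path_edgesE x (ea j) (ob j))).
    case: (in_brick B x) => /=; last by rewrite big1.
    rewrite (sum_at_most_one (B := fun j => path_cells (a j) (b j) x)) // => j j' _ _.
    exact: path_uniq.
  rewrite /rest /in_brick; case: (base B x); case: (x _ \in _); case: [exists j, _] => /=; lia.
apply: tileableD; last by apply: tileable_sum => j _; apply: tileable_path_edges.
apply/tileable_brick/finitary_off_comp2.
  by apply: finitary_offW fin_base => j; rewrite !inE => ->.
apply: (finitary_off_comp negb); apply: finitary_off_coords => [l|x y xy].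
  by apply: contraNneq axis_coord => <-; apply: codom_f.
by apply: eq_existsb => j; rewrite /path_cells (inside_ext xy) (side_ext xy).
Qed.

Lemma tileable_balanced (W : {set L}) :
  #|W :&: even| = #|W :\: even| -> tileable (carve (in_brick B) vertex W).
Proof.
set E := W :&: even; set O := W :\: even => EO.
pose a (j : 'I_#|E|) := enum_val j; pose b (j : 'I_#|E|) := enum_val (cast_ord EO j).
apply: tileable_ext (@tileable_paths _ a b _ _ _ _) => [x|j j' /enum_val_inj//|j j'|j|j].
- congr (_ - _); rewrite big_split [RHS](big_setID even) /=; congr (_ + _).
    by rewrite -(big_enum_val (fun l => nat_of_bool (vertex l x))).
  rewrite (reindex_onto (cast_ord (esym EO)) (cast_ord EO)) => [|j _]; last by rewrite cast_ordK.
  rewrite (eq_big xpredT (fun j => nat_of_bool (vertex (enum_val j) x))) => [|j|j _].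
  + by rewrite -(big_enum_val (fun l => nat_of_bool (vertex l x))).
  + by rewrite cast_ordKV eqxx.
  + by rewrite /b cast_ordKV.
- by move=> /enum_val_inj/cast_ord_inj.
- by have := enum_valP j; rewrite inE => /andP[].
- by have := enum_valP (cast_ord EO j); rewrite inE => /andP[].
Qed.

End Cells.

Definition erasable (L : finType) : Prop :=
  forall (coord : L -> nat) (z : L -> X) (B : brick) (G : pred point),
    injective coord -> axis B \notin codom coord ->
    finitary_off [predU1 axis B & codom coord] (base B) -> finitary_off (mem (codom coord)) G ->
    tileable (fun x => in_brick B x && ~~ (G x && [forall l, x (coord l) == z l])).

Lemma tile_through : exists labels : X -> K, forall y, y \in tile (labels y).
Proof.
apply: (fin_all_exists (P := fun y k => y \in tile k)) => y.
have := t_gt0; rewrite -(degree_t y) /degree sum1_card => /card_gt0P[k].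
by exists k.
Qed.

Lemma exists_erasable : exists L : finType, erasable L.
Proof.
have [through in_through] := tile_through.
have [N balance] := game_balance tileable_game_closed.
exists (option ('I_N + 'I_N) : finType) => coord z B G coord_inj axis_coord fin_base finG.
pose even := [set l : option ('I_N + 'I_N) | if l is Some (inr _) then false else true].
pose upper (l : option ('I_N + 'I_N)) y := (y == z l) (+) (l != None).
pose labels l := through (z l).
have cell_None x : cell coord labels upper None x = [forall l, x (coord l) == z l].
  apply/andP/forallP => [[_ /eqP/setP xz] l|xz].
    by have := xz l; rewrite !inE /upper; case: l => [l|]; case: eqP.
  split; first by apply/forallP=> l; rewrite (eqP (xz l)) in_through.
  by apply/eqP/setP=> l; rewrite !inE /upper xz; case: l.
have leN (h : 'I_N -> option ('I_N + 'I_N)) (S : {set option ('I_N + 'I_N)}) :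
    injective h -> (forall j, h j \in S) -> N <= #|S|.
  move=> h_inj hS; rewrite -[X in X <= _](card_ord N) -(card_codom h_inj) subset_leq_card //.
  by apply/subsetP=> _ /codomP[j ->].
pose P := vertex coord labels upper B G even.
apply: tileable_ext (balance _ (in_brick B) P even None _ _ _ _ _ _) => [x||||||].
- rewrite /carve big_set1 /P /vertex cell_None inE eqb_id.
  by case: (in_brick B x); case: (G x); case: [forall l, _].
- exact: finitary_vertex.
- exact: packed_vertex.
- by rewrite inE.
- by apply: (leN (fun j => Some (inl j))) => [j j' []|j]; rewrite ?inE.
- by apply: (leN (fun j => Some (inr j))) => [j j' []|j]; rewrite ?inE.
- move=> W; exact: tileable_balanced.
Qed.

(** * Filling a sparse hole *)

Lemma exists_spare_coords (L I : finType) (center : I -> point) d n :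
  d + #|L| + #|I| * #|I| <= n ->
  exists coord : L -> nat, [/\ injective coord, forall l, coord l \in index_iota d n
    & forall i i', {in [seq j <- index_iota d n | j \notin codom coord], center i =1 center i'} ->
        {in index_iota d n, center i =1 center i'}].
Proof.
move=> dn.
pose differ (p : I * I) := [pick j : 'I_(n - d) | center p.1 (d + j) != center p.2 (d + j)].
pose used := [set j in pmap differ (enum {: I * I})].
have used_le : #|used| <= #|I| * #|I|.
  rewrite cardsE (leq_trans (card_size _)) // size_pmap (leq_trans (count_size _ _)) //.
  by rewrite -cardE card_prod.
have [|w w_inj w_free] := @exists_inj_into L _ (~: used).
  by rewrite cardsCs setCK card_ord; lia.
exists (fun l => d + w l); split=> [l l' /addnI/ord_inj/w_inj//|l|i i' off_eq j].
  by rewrite mem_index_iota leq_addr -ltn_subRL ltn_ord.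
rewrite mem_index_iota => /andP[dj jn]; apply/eqP/negPn/negP=> cj.
have [k kE] : exists k, differ (i, i') = Some k.
  rewrite /differ; case: pickP => [k _|same]; first by exists k.
  have jd : j - d < n - d by rewrite ltn_sub2r // (leq_ltn_trans dj).
  by have := same (Ordinal jd); rewrite /= subnKC // (negPf cj).
have k_used : k \in used.
  by rewrite inE mem_pmap; apply/mapP; exists (i, i'); rewrite ?mem_enum ?kE.
move: kE; rewrite /differ; case: pickP => //= k' + [kk]; rewrite {k'}kk off_eq ?eqxx //.
rewrite mem_filter mem_index_iota leq_addr -ltn_subRL ltn_ord !andbT.
by apply: contraL k_used => /codomP[l /addnI/ord_inj->]; have := w_free l; rewrite inE.
Qed.

Section Repair.

Variables (L I : finType) (d n : nat) (coord : L -> nat) (center : I -> point) (D : pred point).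
Hypothesis eraseL : erasable L.
Hypothesis coord_inj : injective coord.
Hypothesis coord_tail : forall l, coord l \in index_iota d n.
Let off := [seq j <- index_iota d n | j \notin codom coord].
Hypothesis coord_spare :
  forall i i', {in off, center i =1 center i'} -> {in index_iota d n, center i =1 center i'}.
Hypothesis finD : finitary D.
Hypothesis D_tail : forall x, D x -> exists i, {in index_iota d n, x =1 center i}.

Let slice (x : point) : option I := [pick i | agree off x (center i)].

Let finitary_slice (S : {pred nat}) (o : option I) :
  {in off, forall j, j \notin S} -> finitary_off S (fun x => slice x == o).
Proof.
move=> offS; apply: (finitary_off_family (f := fun i x => agree off x (center i))) => [i|x y xy].
  exact: finitary_off_agree.
by rewrite /slice (eq_pick xy).
Qed.

Lemma slice_holeE x i : slice x = Some i ->
  D x = D (overwrite coord (center i \o coord) x) && [forall l, x (coord l) == center i (coord l)].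
Proof.
have [e De] := finD.
rewrite /slice; case: pickP => // i' /agreeP xi' [<-] {i}; apply/idP/andP => [Dx|[Do /forallP xc]].
  have [i'' xi''] := D_tail Dx; have xc l : x (coord l) = center i' (coord l).
    rewrite xi'' ?coord_tail //; apply: (coord_spare _ (coord_tail l)) => j joff.
    by rewrite -xi' // -xi'' //; move: joff; rewrite mem_filter => /andP[].
  split; last by apply/forallP=> l; rewrite xc.
  by rewrite (De _ x) // => j _; apply: overwrite_id.
rewrite -(De (overwrite coord (center i' \o coord) x)) // => j _.
by apply: overwrite_id => l; apply/eqP.
Qed.

Section BrickRepair.

Variable B : brick.
Hypothesis B_below : brick_below d B.

Definition slice_brick (o : option I) : brick :=
  Brick (fun x => base B x && (slice x == o)) (axis B) (label B).

Let coord_ge l : d <= coord l.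
Proof. by have := coord_tail l; rewrite mem_index_iota => /andP[]. Qed.

Let axis_off : axis B \notin off.
Proof. by rewrite mem_filter mem_index_iota leqNgt (B_below.1) andbF. Qed.

Let axis_coord : axis B \notin codom coord.
Proof.
by apply/negP=> /codomP[l axE]; have := coord_ge l; rewrite -axE leqNgt (B_below.1).
Qed.

Let finitary_slice_base (S : {pred nat}) o :
  {subset S <= [predU1 axis B & codom coord]} -> finitary_off S (base (slice_brick o)).
Proof.
move=> Sax; apply: finitary_off_comp2.
  exists d; apply: depends_onW B_below.2 => j /andP[jd jax]; rewrite inE jd.
  apply/negP=> /Sax; rewrite inE (negPf jax) => /codomP[l jE].
  by have := coord_ge l; rewrite -jE leqNgt jd.
apply: finitary_slice => j joff; apply/negP=> /Sax; rewrite inE => /predU1P[jax|jcoord].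
  by have := axis_off; rewrite -jax joff.
by move: joff; rewrite mem_filter jcoord.
Qed.

Lemma tileable_slice_repair o : tileable (fun x => in_brick (slice_brick o) x && ~~ D x).
Proof.
case: o => [i|].
  pose G x := D (overwrite coord (center i \o coord) x).
  have finG : finitary_off (mem (codom coord)) G by apply: finitary_off_overwrite.
  have := @eraseL coord (center i \o coord) (slice_brick (Some i)) G coord_inj axis_coord
    (finitary_slice_base _ (fun _ => id)) finG.
  apply: tileable_ext => x; rewrite /in_brick /slice_brick /=.
  by case: eqP => [/slice_holeE->//|]; rewrite andbF.
apply: (@tileable_ext (fun x => in_brick (slice_brick None) x)) => [x|].
  rewrite /in_brick /slice_brick /= /slice; case: pickP => [i _|no_i]; first by rewrite andbF.
  case Dx: (D x); rewrite ?andbT //; have [i xi] := D_tail Dx.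
  have /agreeP : {in off, x =1 center i} by move=> j; rewrite mem_filter => /andP[_]; apply: xi.
  by rewrite no_i.
by apply/tileable_brick/finitary_slice_base => j; rewrite !inE => ->.
Qed.

Lemma tileable_brick_repair : tileable (fun x => in_brick B x && ~~ D x).
Proof.
apply: (@tileable_ext (fun x => \sum_o (in_brick (slice_brick o) x && ~~ D x))) => [x|].
  rewrite /in_brick /slice_brick /= (bigD1 (slice x)) //= eqxx andbT big1 ?addn0 // => o.
  by rewrite eq_sym => /negPf->; rewrite andbF.
by apply: tileable_sum => o _; apply: tileable_slice_repair.
Qed.

End BrickRepair.

Lemma tileable_repair f : tileable_below d f -> tileable (fun x => f x * ~~ D x).
Proof.
move=> [J [B [Bd fE]]].
apply: (@tileable_ext (fun x => \sum_j (in_brick (B j) x && ~~ D x))) => [x|].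
  by rewrite fE big_distrl /=; apply: eq_bigr => j _; rewrite mulnb.
by apply: tileable_sum => j _; apply: tileable_brick_repair.
Qed.

End Repair.

Lemma exists_free_axis (b N d : nat) (O : pred point) (y : point) :
  depends_on [pred j | j < d] O -> sparse b N O -> b <= d -> 2 * N < b ->
  exists l : 'I_b, forall (s : seq 'I_b) x, size s <= 2 -> O x ->
    {in [pred j | (j < d) && (j \notin [seq val i | i <- s])], x =1 y} -> x l = y l.
Proof.
move=> Od sparseO bd Nb; pose diff (w : {ffun 'I_b -> X}) := [set j : 'I_b | w j != y j].
pose close := [set w | O (set_window w y) & #|diff w| <= 2].
have [w||l l_free] := @exists_uncovered _ _ close diff 2.
- by rewrite inE => /andP[].
- rewrite card_ord; apply: leq_ltn_trans Nb; rewrite leq_mul2l /=.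
  apply: leq_trans (sparseO y); apply/subset_leq_card/subsetP=> w.
  by rewrite !inE => /andP[].
exists l => s x s2 Ox xy; apply/eqP/negPn/negP=> xyl.
suff /l_free/negP[] : window b x \in close by rewrite inE ffunE.
rewrite inE; apply/andP; split.
  rewrite (Od _ x) // => j; rewrite inE => jd.
  case: (ltnP j b) => [jb|bj]; first exact: set_window_lt.
  rewrite set_window_ge // -xy // inE jd; apply/mapP=> -[i _ ji].
  by move: (ltn_ord i); rewrite ltnNge -[X in b <= X]ji bj.
apply: leq_trans s2; apply: leq_trans (card_size s); apply/subset_leq_card/subsetP=> j.
rewrite inE ffunE; apply: contraNT => js; apply/eqP/xy.
by rewrite inE (leq_trans (ltn_ord j)) //= mem_map //; apply: val_inj.
Qed.

Section Fill.

Variables (L I : finType) (b N d n : nat) (O : pred point) (through : X -> K) (center : I -> point).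
Hypothesis eraseL : erasable L.
Hypothesis in_through : forall y, y \in tile (through y).
Hypothesis O_below : depends_on [pred j | j < d] O.
Hypothesis belowO : tileable_below d (fun x => ~~ O x).
Hypothesis sparseO : sparse b N O.
Hypothesis b_large : 2 * N < b.
Hypothesis leq_bd : b <= d.
Hypothesis n_large : d + #|L| + #|I| * #|I| <= n.
Hypothesis O_center : forall i, O (center i).
Hypothesis center_inj : forall i i', agree (iota 0 n) (center i) (center i') -> i = i'.

Section Lines.

Variable dir : I -> 'I_b.
Hypothesis dir_free : forall i (s : seq 'I_b) x, size s <= 2 -> O x ->
  {in [pred j | (j < d) && (j \notin [seq val i | i <- s])], x =1 center i} ->
  x (dir i) = center i (dir i).

Let leq_dn : d <= n. Proof. by apply: leq_trans n_large; rewrite -addnA leq_addr. Qed.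
Let dir_lt i : nat_of_ord (dir i) \in iota 0 n.
Proof. by rewrite mem_iota (leq_trans (ltn_ord _)) // (leq_trans leq_bd). Qed.

Definition off_axis (i : I) : seq nat := [seq j <- iota 0 n | j != dir i :> nat].

Definition line (i : I) : pred point :=
  fun x => agree (off_axis i) x (center i) && (x (dir i) \in tile (through (center i (dir i)))).

Definition hit (i : I) : pred point := fun x => line i x && (x (dir i) != center i (dir i)).

Lemma line_split i x : line i x = hit i x + agree (iota 0 n) x (center i) :> nat.
Proof.
rewrite (agree_filter _ _ (dir_lt i)) /hit /line; case: (agree _ x _) => //=.
by case: eqP => [->|_] /=; rewrite ?in_through ?andbT ?addn0.
Qed.

Lemma mem_off_axis i j : (j \in off_axis i) = (j < n) && (j != dir i :> nat).
Proof. by rewrite mem_filter mem_iota andbC. Qed.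

Lemma hit_not_hole i x : hit i x -> ~~ O x.
Proof.
move=> /andP[/andP[/agreeP xcenter _] x_dir]; apply: contra x_dir => Ox; apply/eqP.
apply: (dir_free (s := [:: dir i])) => // j; rewrite !inE => /andP[jd jdir].
by rewrite xcenter // mem_off_axis jdir (leq_trans jd leq_dn).
Qed.

Lemma hit_inj i i' x : hit i x -> hit i' x -> i = i'.
Proof.
move=> /andP[/andP[/agreeP xcenter _] x_dir] /andP[/andP[/agreeP xcenter' _] _].
have centers_eq j :
    j < n -> j != dir i :> nat -> j != dir i' :> nat -> center i' j = center i j.
  by move=> jn jdir jdir'; rewrite -xcenter ?mem_off_axis ?jn // xcenter' // mem_off_axis jn.
have axis_eq : center i' (dir i) = center i (dir i).
  apply: (dir_free (s := [:: dir i; dir i']) _ (O_center i')) => // j.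
  rewrite !inE negb_or => /and3P[jd jdir jdir'].
  by rewrite centers_eq // (leq_trans jd leq_dn).
apply/esym/center_inj/agreeP=> j; rewrite mem_iota => /= jn.
case: (eqVneq j (dir i)) => [->//|jdir].
case: (eqVneq j (dir i')) => [jdir'|]; last exact: centers_eq.
by case/eqP: x_dir; rewrite -axis_eq xcenter' // mem_filter dir_lt -jdir' eq_sym jdir.
Qed.

Lemma tileable_line i : tileable (line i).
Proof.
apply/tileable_brick/finitary_off_agree => j; rewrite mem_off_axis inE.
by case/andP.
Qed.

Lemma tileable_unhit : tileable (fun x => ~~ O x * ~~ [exists i, hit i x]).
Proof.
have [coord [coord_inj coord_tail coord_spare]] := exists_spare_coords center n_large.
apply: (tileable_repair eraseL coord_inj coord_tail coord_spare) belowO => [|x].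
  apply: (finitary_off_family (f := hit)) => [i|x y xy]; last exact: eq_existsb.
  apply: finitary_off_comp2; last first.
    by apply: (finitary_off_comp (fun a => a != center i (dir i))); apply: finitary_off_coord.
  apply: finitary_off_comp2; first exact: finitary_off_agree.
  by apply: (finitary_off_comp (mem (tile _))); apply: finitary_off_coord.
move=> /existsP[i /andP[/andP[/agreeP xcenter _] _]]; exists i => j.
rewrite mem_index_iota => /andP[dj jn]; apply: xcenter; rewrite mem_off_axis jn.
by rewrite gtn_eqF // (leq_trans (ltn_ord _)) // (leq_trans leq_bd).
Qed.

End Lines.

Lemma tileable_fill : tileable (fun x => ~~ O x + \sum_i agree (iota 0 n) x (center i)).
Proof.
have /fin_all_exists[dir dir_free] i := exists_free_axis (center i) O_below sparseO leq_bd b_large.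
have lines := tileable_sum (index_enum I) (P := xpredT) (fun i _ => tileable_line dir i).
apply: tileable_ext (tileableD (tileable_unhit dir) lines) => x.
rewrite (eq_bigr _ (fun i _ => line_split dir i x)) big_split /= addnA; congr (_ + _).
rewrite sum_at_most_one => [|i i' _ _]; last exact: (hit_inj dir_free).
rewrite /=; case: existsP => [[i hx]|_]; last by rewrite muln1 addn0.
by rewrite muln0 (hit_not_hole dir_free hx).
Qed.

End Fill.

Lemma tileable_space (x0 : X) : tileable (fun=> 1).
Proof.
have [through in_through] := tile_through.
have [L eraseL] := exists_erasable.
pose b := (2 * #|K|).+1.
have [O [[d1 O_below] sparseO [d2 belowO]]] := sparse_hole b.
pose d := maxn b (maxn d1 d2); pose n := d + #|L| + #|K| * #|K|.
have {}O_below : depends_on [pred j | j < d] O.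
  by apply: depends_onW O_below => j; rewrite !inE andbT /d; lia.
have {}belowO : tileable_below d (fun x => ~~ O x).
  by apply: tileable_below_leq belowO; rewrite /d; lia.
pose extend (w : {ffun 'I_n -> X}) : point := set_window w (fun=> x0).
pose S := [set w | O (extend w)].
have O_window x : O x = (window n x \in S).
  rewrite inE; apply: O_below => j; rewrite inE => jd.
  by rewrite /extend set_window_lt // /n; lia.
apply: (game_few_pieces tileable_game_closed (P := fun w x => window n x == w) (S := S)).
- by move=> w; apply: (finitary_window (fun v => v == w)).
- by move=> x; rewrite sum_eq_mem leq_b1.
move=> D DS few; pose center (i : 'I_(#|S :\: D|)) := extend (enum_val i).
have n_large : d + #|L| + #|'I_(#|S :\: D|)| * #|'I_(#|S :\: D|)| <= n.
  by rewrite card_ord leq_add2l leq_mul.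
have agree_center i x : agree (iota 0 n) x (center i) = (window n x == enum_val i).
  by rewrite agree_window /center /extend window_set_window.
have filled := tileable_fill eraseL in_through O_below belowO sparseO _ _ n_large.
apply: tileable_ext (filled center _ _ _ _) => [x|||i|i i'].
- have -> : \sum_i agree (iota 0 n) x (center i) = (window n x \in S :\: D).
    rewrite -sum_eq_mem [RHS]big_enum_val; apply: eq_bigr => i _.
    by rewrite agree_center.
  rewrite /carve sum_eq_mem O_window in_setD; have := subsetP DS (window n x).
  by case: (window n x \in D); case: (window n x \in S) => //= /(_ isT).
- exact: ltnSn.
- exact: leq_maxl.
- by have := enum_valP i; rewrite !inE => /andP[].
- by rewrite agree_center /center /extend window_set_window => /eqP/enum_val_inj.
Qed.

End Covers.

End Bricks.

Import GRing.Theory.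
Local Open Scope ring_scope.

(** * Covers of a finite abelian group by translates *)

Section Translates.

Variables (V : finZmodType) (S : {set V}).

Definition translate (g : V) : {set V} := [set y | y - g \in S].

Lemma degree_translate w y : degree translate w y = (\sum_(s in S) w (y - s)%R)%N.
Proof.
rewrite /degree (reindex_inj (subrI y)); apply: eq_bigl => s.
by rewrite inE subKr.
Qed.

End Translates.

(* The library does not join the finite and the additive structures of [{ffun I -> W}]. *)
HB.instance Definition _ (I : finType) (W : finZmodType) := GRing.Zmodule.on {ffun I -> W}.

Section Shift.

Variables (V : finZmodType) (p : nat).
Hypothesis p_prime : prime p.

Definition shift (f : {ffun V -> 'F_p}) (v : V) : {ffun V -> 'F_p} := [ffun x => f (x + v)].

Lemma shift_is_action : is_action [set: V]%g shift.
Proof.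
apply: is_total_action => [f|f v w]; apply/ffunP=> x; rewrite !ffunE ?addr0 //.
by rewrite FinRing.zmodMgE addrCA addrC -addrA.
Qed.

Canonical shift_action := Action shift_is_action.

Lemma exists_fixed_nonzero (M : {group {ffun V -> 'F_p}}) (G : {group V}) :
  p.-group%g G -> [acts G, on M | shift_action] -> M :!=: 1%g ->
  exists2 f, f \in 'Fix_(M | shift_action)(G)%g & f != 0.
Proof.
move=> pG actsM M1.
have pM : p.-group%g M.
  apply: pgroupS (subsetT _) _; rewrite /pgroup cardsT card_ffun card_Fp // pnatX.
  by rewrite pnat_id.
have [_ p_dvd_M _] := pgroup_pdiv pM M1.
have : (p %| #|'Fix_(M | shift_action)(G)%g|)%N.
  by rewrite /dvdn -(pgroup_fix_mod pG actsM).
have fix0 : (0 : {ffun V -> 'F_p}) \in 'Fix_(M | shift_action)(G)%g.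
  rewrite inE (group1 M); apply/afixP=> v _ /=.
  by apply/ffunP=> x; rewrite !ffunE.
rewrite (cardsD1 0) fix0 add1n => /dvdn_leq-/(_ isT)/(leq_trans (prime_gt1 p_prime)).
rewrite ltnS => /card_gt0P[f].
by rewrite in_setD1 => /andP[f0 fixf]; exists f.
Qed.

End Shift.

Section ModularCover.

Variables (V : finZmodType) (p : nat) (S : {set V}).
Hypothesis p_prime : prime p.

Definition convolve (u : {ffun V -> 'F_p}) : {ffun V -> 'F_p} :=
  [ffun x => \sum_(s in S) u (x - s)].

Lemma convolveD : {morph convolve : u v / u + v}.
Proof.
move=> u v; apply/ffunP=> x; rewrite !ffunE -big_split.
by apply: eq_bigr => s _; rewrite ffunE.
Qed.

Lemma convolve_shift u v : convolve (shift u v) = shift (convolve u) v.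
Proof. by apply/ffunP=> x; rewrite !ffunE; apply: eq_bigr => s _; rewrite ffunE addrAC. Qed.

Definition convolutions (Q : {set V}) : {set {ffun V -> 'F_p}} :=
  convolve @: 'Fix_(shift_action V p)(Q)%g.

Lemma convolutions_group_set Q : group_set (convolutions Q).
Proof.
apply/group_setP; split=> [|_ _ /imsetP[u fu ->] /imsetP[v fv ->]].
  apply/imsetP; exists 0; first by apply/afixP=> w _; apply/ffunP=> x; rewrite !ffunE.
  by apply/ffunP=> x; rewrite !ffunE big1 // => s _; rewrite ffunE.
apply/imsetP; exists (u + v); last by rewrite FinRing.zmodMgE convolveD.
apply/afixP=> w wQ; have /ffunP fu_w := afixP fu w wQ; have /ffunP fv_w := afixP fv w wQ.
by apply/ffunP=> x; have := fu_w x; have := fv_w x; rewrite !ffunE => -> ->.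
Qed.

Canonical convolutions_group Q := Group (convolutions_group_set Q).

Lemma acts_convolutions (G Q : {set V}) : [acts G, on convolutions Q | shift_action V p].
Proof.
apply/subsetP=> v _; rewrite !inE /=; apply/subsetP=> _ /imsetP[u fu ->].
rewrite inE /= -convolve_shift imset_f //; apply/afixP=> w wQ /=.
have /ffunP fu_w := afixP fu w wQ.
by apply/ffunP=> x; have := fu_w (x + v); rewrite !ffunE addrAC.
Qed.

Hypothesis S_neq0 : S != set0.
Hypothesis S_separated :
  forall s s' c, s \in S -> s' \in S -> coprime p c -> (s - s') *+ c = 0 -> s = s'.

Local Notation P := ('O_p([set: V])%G).
Local Notation Q := ('O_p^'([set: V])%G).

Lemma pcore_p'_torsion x : x \in Q -> exists2 c, coprime p c & x *+ c = 0.
Proof.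
move=> xQ; exists #[x]%g; last by rewrite -FinRing.zmodXgE expg_order.
have := mem_p_elt (pcore_pgroup _ _) xQ.
by rewrite /p_elt p'natE ?order_gt0 // prime_coprime.
Qed.

Lemma convolutions_neq1 : convolutions Q != 1%g.
Proof.
have [s0 s0S] := set0Pn _ S_neq0.
apply/trivgPn; exists (convolve [ffun x => (x \in Q)%:R]).
  apply: imset_f; apply/afixP=> v vQ; apply/ffunP=> x; rewrite !ffunE.
  by rewrite -FinRing.zmodMgE groupMr.
apply/eqP=> /ffunP/(_ s0); rewrite !ffunE (bigD1 s0) //= big1 => [|s /andP[sS ss0]].
  by rewrite subrr ffunE group1 addr0 => /eqP; rewrite oner_eq0.
rewrite ffunE; case: (boolP (_ \in Q)) => // /pcore_p'_torsion[c pc /S_separated s0s].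
by rewrite s0s ?eqxx in ss0.
Qed.

Lemma fixed_PQ_const (f : {ffun V -> 'F_p}) x :
  f \in 'Fix_(shift_action V p)(P)%g -> f \in 'Fix_(shift_action V p)(Q)%g -> f x = f 0.
Proof.
move=> fP fQ; have abV : abelian [set: V] by apply: FinRing.zmod_abelian.
have : x \in (P * Q)%g by rewrite (dprodW (nilpotent_pcoreC p (abelian_nil abV))) inE.
case/mulsgP=> v w vP wQ ->; rewrite FinRing.zmodMgE addrC.
have /ffunP/(_ w) := afixP fP v vP; rewrite ffunE => ->.
by have /ffunP/(_ 0) := afixP fQ w wQ; rewrite ffunE add0r.
Qed.

Lemma exists_modular_cover : exists u : V -> 'F_p, forall x, \sum_(s in S) u (x - s) = 1.
Proof.
have [g] := exists_fixed_nonzero p_prime (pcore_pgroup p [set: V]) (acts_convolutions _ Q)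
  convolutions_neq1.
rewrite inE => /andP[/imsetP[u uQ ->] uP] /eqP u_neq0.
have const x : convolve u x = convolve u 0.
  apply: fixed_PQ_const => //; apply/afixP=> w wQ /=.
  by rewrite -convolve_shift; congr convolve; apply: (afixP uQ).
have u0_neq0 : convolve u 0 != 0.
  by apply: contra_not_neq u_neq0 => u00; apply/ffunP=> x; rewrite const u00 !ffunE.
exists (fun x => (convolve u 0)^-1 * u x) => x.
by rewrite -mulr_sumr -(mulVf u0_neq0); congr (_ * _); rewrite -(const x) ffunE.
Qed.

End ModularCover.

Lemma translate_cover_mod (V : finZmodType) (S : {set V}) p :
  prime p -> S != set0 ->
  (forall s s' c, s \in S -> s' \in S -> coprime p c -> (s - s') *+ c = 0 -> s = s') ->
  exists w : V -> nat, forall y, (degree (translate S) w y = 1 %[mod p])%N.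
Proof.
move=> p_prime S0 S_sep; have [u u1] := exists_modular_cover p_prime S0 S_sep.
exists u => y; rewrite degree_translate -!(val_Fp_nat p_prime); congr (nat_of_ord _).
by rewrite natr_sum -[RHS](u1 y); apply: eq_bigr => s _; rewrite natr_Zp.
Qed.

(** * Reduction of the integer lattice modulo m *)

Section Torus.

Variables (n m : nat).
Hypothesis m_gt1 : (1 < m)%N.

Definition torus : finZmodType := 'rV['Z_m]_n.

Definition reduce (x : pt n) : torus := \row_i (x i)%:~R.

Lemma reduce_is_zmod_morphism : zmod_morphism reduce.
Proof. by move=> x y; apply/rowP=> i; rewrite !mxE !ffunE rmorphB. Qed.

HB.instance Definition _ :=
  GRing.isZmodMorphism.Build (pt n) torus reduce reduce_is_zmod_morphism.

Lemma intr_Zp_eq0 (z : int) : (z%:~R == 0 :> 'Z_m) = (m %| z)%Z.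
Proof.
have abs_eq0 (k : nat) : (k%:R == 0 :> 'Z_m) = (m %| k)%N.
  by rewrite -val_eqE /= val_Zp_nat.
by case: z => k; rewrite ?NegzE ?rmorphN ?oppr_eq0 -?pmulrn abs_eq0 dvdzE.
Qed.

Lemma reduce_eq0 x : reduce x = 0 <-> forall i, (m %| x i)%Z.
Proof.
split=> [/rowP x0 i|x0]; last by apply/rowP=> i; rewrite !mxE; apply/eqP; rewrite intr_Zp_eq0.
by rewrite -intr_Zp_eq0; have := x0 i; rewrite !mxE => ->.
Qed.

Variable T : {fset pt n}.

Definition distinct_mod (q : nat) : Prop :=
  forall s s', s \in T -> s' \in T -> (forall i, (q %| s i - s' i)%Z) -> s = s'.

Definition reduced_tile : {set torus} := [set x in [seq reduce s | s <- T]].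

Lemma mem_reduced_tile x : reflect (exists2 s, s \in T & x = reduce s) (x \in reduced_tile).
Proof. by rewrite inE; apply: mapP. Qed.

Lemma reduce_inj : distinct_mod m -> {in T &, injective reduce}.
Proof.
move=> T_m s s' sT s'T /eqP; rewrite -subr_eq0 -raddfB => /eqP/reduce_eq0 ss'.
by apply: T_m => // i; have := ss' i; rewrite !ffunE.
Qed.

Lemma card_reduced_tile : distinct_mod m -> #|reduced_tile| = #|` T|.
Proof.
move=> T_m; rewrite cardsE (card_uniqP _) ?size_map //.
by rewrite map_inj_in_uniq ?fset_uniq //; apply: reduce_inj.
Qed.

Lemma reduced_tile_cover_mod p e :
  prime p -> T != fset0 -> (p ^ e %| m)%N -> distinct_mod (p ^ e) ->
  exists w, forall y, (degree (translate reduced_tile) w y = 1 %[mod p])%N.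
Proof.
move=> p_prime /fset0Pn[s0 s0T] pe_m T_pe; apply: translate_cover_mod => // [|x x' c].
  by apply/set0Pn; exists (reduce s0); apply/mem_reduced_tile; exists s0.
move=> /mem_reduced_tile[s sT ->] /mem_reduced_tile[s' s'T ->] pc.
rewrite -raddfB -raddfMn => /reduce_eq0 m_dvd; congr reduce; apply: T_pe => // i.
have : ((p ^ e)%N %| (s i - s' i) * c%:Z)%Z.
  apply: dvdz_trans (_ : (m %| _)%Z); first by rewrite dvdzE.
  by have := m_dvd i; rewrite ffunMnE !ffunE -mulr_natr natz.
by rewrite Gauss_dvdzl // coprimezE coprimeXl.
Qed.

End Torus.

Lemma distinct_mod_large n (T : {fset pt n}) :
  exists e : nat, forall q, (2 ^ e <= q)%N -> distinct_mod T q.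
Proof.
pose N := (\sum_(s <- T) \sum_i `|s i|)%N; exists N.*2 => q Nq s s' sT s'T q_dvd.
have bound (u : pt n) i : u \in T -> (`|u i| <= N)%N.
  by move=> uT; rewrite /N (big_fsetD1 u) //= (bigD1 i) //= -addnA leq_addr.
apply/ffunP=> i; apply/eqP; rewrite -subr_eq0 -absz_eq0; apply: contraT; rewrite -lt0n => pos.
have := q_dvd i; rewrite dvdzE /= => /(dvdn_leq pos).
have := bound s i sT; have := bound s' i s'T; have := ltn_expl N.*2 (ltnSn 1).
move: Nq; move: (2 ^ _)%N (s i) (s' i) => M a b.
lia.
Qed.

(** * Blocks of coordinates *)

Lemma dist2_addl d (a x y : pt d) : dist2 (a + x) (a + y) = dist2 x y.
Proof. by apply: eq_bigr => i _; rewrite !ffunE opprD addrACA subrr add0r. Qed.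

Section Blocks.

Variables (n D : nat).
Hypothesis n_gt0 : (0 < n)%N.
Local Notation d := (D * n)%N.

Definition block (z : pt d) (j : nat) : pt n :=
  [ffun i : 'I_n => oapp z 0 (insub (j * n + i)%N)].

Definition put (j : nat) (s : pt n) : pt d :=
  [ffun q : 'I_d => if (q %/ n == j)%N then s (Ordinal (ltn_pmod q n_gt0)) else 0].

Lemma block_index_lt j (i : 'I_n) : (j < D)%N -> (j * n + i < d)%N.
Proof.
move=> jD; apply: (@leq_trans (j.+1 * n)).
  by rewrite mulSn addnC ltn_add2r.
by rewrite leq_mul2r jD orbT.
Qed.

Lemma blockD x y j : block (x + y) j = block x j + block y j.
Proof. by apply/ffunP=> i; rewrite !ffunE; case: insubP => [q _ _|_] /=; rewrite ?ffunE ?addr0. Qed.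

Lemma putN j s : put j (- s) = - put j s.
Proof. by apply/ffunP=> q; rewrite !ffunE; case: ifP; rewrite ?oppr0. Qed.

Lemma block_put i s j : (i < D)%N -> block (put i s) j = if j == i then s else 0.
Proof.
move=> iD; apply/ffunP=> l; rewrite ffunE; case: insubP => [q _ qE|] /=.
  have {}qE : nat_of_ord q = (j * n + l)%N := qE.
  rewrite ffunE {1}qE divnMDl // divn_small // addn0; case: eqP => _; last by rewrite ffunE.
  by congr (s _); apply: val_inj; rewrite /= qE modnMDl modn_small.
case: eqP => [->|_]; last by rewrite ffunE.
by rewrite block_index_lt.
Qed.

Lemma embed_put (x : pt n) : embed d x = put 0 x.
Proof.
apply/ffunP=> q; rewrite !ffunE; case: insubP => [j _ jE|].
  have qn : (q < n)%N by rewrite -[X in (X < _)%N]jE ltn_ord.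
  by rewrite divn_small // eqxx; congr (x _); apply: val_inj; rewrite /= modn_small // -jE.
by rewrite -leqNgt => nq; rewrite gtn_eqF // divn_gt0.
Qed.

Lemma dist2_put i x y : (i < D)%N -> dist2 (put i x) (put i y) = dist2 x y.
Proof.
move=> iD; rewrite /dist2 (bigID (fun q : 'I_d => (q %/ n == i)%N)) /=.
rewrite [X in _ + X]big1 ?addr0 => [|q /negPf qi]; last by rewrite !ffunE qi subrr expr0n.
rewrite (reindex_onto (fun j : 'I_n => Ordinal (block_index_lt j iD))
  (fun q => Ordinal (ltn_pmod q n_gt0))) => [|q /eqP qi].
  have div_i (j : 'I_n) : ((i * n + j) %/ n)%N == i by rewrite divnMDl // divn_small ?addn0.
  have mod_j (j : 'I_n) : Ordinal (ltn_pmod (i * n + j) n_gt0) = j.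
    by apply: val_inj; rewrite /= modnMDl modn_small.
  apply: eq_big => [j|j _]; first by rewrite /= div_i mod_j eqxx.
  by rewrite !ffunE /= div_i mod_j.
by apply: val_inj; rewrite /= -qi -divn_eq.
Qed.

Lemma put_copy (T : {fset pt n}) i a : (i < D)%N ->
  is_copy T (fun z => exists2 s, s \in T & z = a + put i s).
Proof.
move=> iD; have D_gt0 : (0 < D)%N by apply: leq_ltn_trans iD.
have head s : block (embed d s) 0 = s by rewrite embed_put block_put.
exists (fun y => a + put i (block y 0)); split=> [s sT|]; first by exists s; rewrite ?head.
split=> [_ [s sT ->]|s s' sT s'T]; first by exists s; rewrite ?head.
by rewrite !head dist2_addl dist2_put // !embed_put dist2_put.
Qed.

End Blocks.

Section Lifting.

Variables (n m D : nat) (T : {fset pt n}).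
Hypothesis n_gt0 : (0 < n)%N.
Hypothesis m_gt1 : (1 < m)%N.
Hypothesis T_m : distinct_mod T m.

Local Notation d := (D * n)%N.
Local Notation tile := (translate (reduced_tile m T)).
Local Notation brick := (brick (torus n m) (torus n m)).

Definition code (z : pt d) : nat -> torus n m := fun j => reduce m (block z j).

Definition anchored (B : brick) (a : pt d) : bool :=
  base B (code a) && (code a (axis B) == label B).

Definition piece (B : brick) (a : pt d) : pt d -> Prop :=
  fun z => exists2 s, s \in T & z = a + put D n_gt0 (axis B) s.

Lemma code_put_axis a i s : (i < D)%N ->
  code (a + put D n_gt0 i s) i = code a i + reduce m s.
Proof. by move=> iD; rewrite /code blockD block_put // eqxx raddfD. Qed.

Lemma base_put (B : brick) a s : brick_below D B ->
  base B (code (a + put D n_gt0 (axis B) s)) = base B (code a).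
Proof.
move=> [axD baseB]; apply: baseB => j /andP[_ /negPf jax].
by rewrite /code blockD block_put // jax addr0.
Qed.

Lemma in_brick_piece (B : brick) a z : brick_below D B ->
  anchored B a -> piece B a z -> in_brick tile B (code z).
Proof.
move=> Bd /andP[base_a /eqP ax_a] [s sT ->]; have [axD _] := Bd.
rewrite /in_brick base_put // base_a inE code_put_axis // ax_a addrC addKr.
by apply/mem_reduced_tile; exists s.
Qed.

Lemma exists_piece (B : brick) z : brick_below D B ->
  in_brick tile B (code z) -> exists2 a, anchored B a & piece B a z.
Proof.
move=> Bd /andP[base_z]; have [axD _] := Bd; rewrite inE => /mem_reduced_tile[s sT ax_z].
exists (z + put D n_gt0 (axis B) (- s)); last by exists s; rewrite // putN subrK.
by rewrite /anchored base_put // base_z code_put_axis // raddfN /= -ax_z subKr.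
Qed.

Lemma piece_uniq (B : brick) a a' z : brick_below D B ->
  anchored B a -> anchored B a' -> piece B a z -> piece B a' z -> a = a'.
Proof.
move=> [axD _] /andP[_ /eqP ax_a] /andP[_ /eqP ax_a'] [s sT zE] [s' s'T zE'].
have ss' : s = s'.
  apply: (reduce_inj m_gt1 T_m sT s'T); apply: (addrI (label B)).
  by rewrite -[in LHS]ax_a -ax_a' -!code_put_axis // -zE -zE'.
by move: zE; rewrite zE' ss' => /addIr.
Qed.

Lemma tiles_lift : tileable_below tile D (fun=> 1%N) -> tiles T d.
Proof.
move=> [J [B [Bd one]]].
exists {ja : J * pt d | anchored (B ja.1) ja.2}, (fun ja => piece (B (sval ja).1) (sval ja).2).
split=> [[[j a] /= _]|z]; first by apply: put_copy; case: (Bd j).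
have /eqP := one (code z); rewrite eq_sym => /sum_nat_eq1[j [_ jz j_uniq]].
have [a aj za] : exists2 a, anchored (B j) a & piece (B j) a z.
  by apply: exists_piece (Bd j) _; case: (in_brick _ _ _) jz.
exists (exist _ (j, a) aj); split=> // -[[j' a'] /= aj'] za'.
apply: val_inj => /=; have jj' : j' = j.
  apply/eqP/negPn/negP=> /j_uniq/(_ isT) /eqP.
  by rewrite eqb0 (in_brick_piece (Bd j') aj' za').
by subst j'; congr (_, _); apply: piece_uniq (Bd j) aj aj' za za'.
Qed.

End Lifting.

Theorem theorem1 (n : nat) (T : {fset pt n}) :
  (1 <= n)%N -> is_tile T -> exists d : nat, (n <= d)%N /\ tiles T d.
Proof.
move=> n_gt0 T0; have [e T_distinct] := distinct_mod_large T.
have T_gt0 : (0 < #|` T|)%N by rewrite cardfs_gt0.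
pose m := ((2 * #|` T|) ^ e.+1)%N.
have m_large : (2 ^ e.+1 <= m)%N by rewrite leq_exp2r // leq_pmulr.
have m_gt1 : (1 < m)%N by apply: leq_trans m_large; rewrite -[1%N](expn0 2) ltn_exp2l.
have T_m : distinct_mod T m.
  by apply: T_distinct; apply: leq_trans m_large; rewrite leq_exp2l.
have degree_T y : degree (translate (reduced_tile m T)) (fun=> 1%N) y = #|` T|.
  by rewrite degree_translate sum1_card card_reduced_tile.
have [|D below_D] := tileable_space T_gt0 degree_T _ 0.
  move=> p p_prime pT; apply: (@reduced_tile_cover_mod _ _ m_gt1 T p e.+1) => //.
    by rewrite dvdn_exp2r // dvdn_mull.
  apply: T_distinct; apply: (@leq_trans (2 ^ e.+1)); first by rewrite leq_exp2l.
  by rewrite leq_exp2r ?prime_gt1.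
exists (D.+1 * n)%N; split; first by rewrite leq_pmull.
by apply: (tiles_lift n_gt0 m_gt1 T_m); apply: tileable_below_leq below_D.
Qed.
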